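(* Let $0<L<U$, $\beta\in(0,L/2)$, let $\omega$ be as in the context and $\Phi(w)=L+\beta+(\omega L-L-2\beta)\exp(\omega w)$. Let $g_t:[0,1]\to\mathbb{R}_{\ge0}$ be concave with $g_t(0)=0$ and $L\le g_t'\le U$, and let $x_{t-1}\in[0,1]$, $w^{(t-1)}\in[0,1]$ be fixed. Then $$f_t(x)=g_t(x)-\beta|x-x_{t-1}|-\int_{w^{(t-1)}}^{w^{(t-1)}+x}\Phi(u)\,du$$ is concave on the entire interval $x\in[0,1]$, for any $t\in[T]$.
   Context: Here $\omega=W\!\left(\frac{U/L-1-2\beta/L}{e^{1+2\beta/L}}\right)+1+\frac{2\beta}{L}$, with $W$ the Lambert $W$ function. In the online conversion problem with switching costs (maximization variant), $g_t$ is the price function revealed at time $t$, $x_{t-1}$ is the previous decision and $w^{(t-1)}$ the cumulative amount sold before time $t$; $\Phi$ is the threshold function of the algorithm RORO-max, and $f_t$ is the objective of its combined ramping-on/ramping-off subproblem.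
   Formalization: The condition L+2β ≤ U is added: if U < L+2β then W<0, Φ is strictly decreasing, and f_t is strictly convex for linear g_t with x_{t-1}=0 (e.g. L=1, β=0.4, U=1.5, g_t(x)=x), so the claim fails as stated. *)

(* Defs.v *)
From HB Require Import structures.
From mathcomp Require Import all_boot all_order all_algebra.
From mathcomp Require Import all_classical all_reals all_analysis.
From mathcomp Require Import ring lra.
Set Implicit Arguments.
Unset Strict Implicit.
Unset Printing Implicit Defensive.
Import Order.TTheory GRing.Theory Num.Theory.
Import numFieldNormedType.Exports.
Local Open Scope classical_set_scope.
Local Open Scope ring_scope.

Definition concave_function (R : realType) (D : set R) (f : R -> R) : Prop :=
  convex_function D (\- f).

(* Principal real branch, inverse of y |-> y e^y on [-1, +oo[; the value for
   z < - e^-1, where that branch is undefined, is the junk value 0. *)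
Definition lambertW (R : realType) (z : R) : R :=
  xget 0 [set y | -1 <= y /\ y * expR y = z].

Lemma mul_expR_lt (R : realType) (a b : R) :
  -1 <= a -> a < b -> a * expR a < b * expR b.
Proof.
move=> a1 ab; have ab' : 0 < b - a by rewrite subr_gt0.
have h : 1 + (b - a) < expR (b - a) by apply: expR_gt1Dx; rewrite gt_eqF.
have -> : expR b = expR a * expR (b - a) by rewrite -expRD subrKC.
rewrite mulrCA [ltLHS]mulrC ltr_pM2l ?expR_gt0//.
have [b0|b0] := leP 0 b.
  by rewrite (lt_le_trans ab)// ler_peMr// ltW// (lt_trans _ h)// ltrDl.
have h2 : 1 + (a - b) < expR (a - b).
  by apply: expR_gt1Dx; rewrite lt_eqF ?subr_lt0.
have aF : a * expR (a - b) < b by nra.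
rewrite -(ltr_pM2r (expR_gt0 (a - b))) -mulrA -expRD.
by rewrite -[a - b]opprB subrr expR0 mulr1 opprB.
Qed.

Lemma lambertWK (R : realType) (y : R) :
  -1 <= y -> lambertW (y * expR y) = y.
Proof.
move=> y1; rewrite /lambertW.
have [v _ [v1 vy]|/(_ y)] := xgetP; last by case; split.
by have [/(mul_expR_lt v1)|/(mul_expR_lt y1)|//] := ltgtP v y;
  rewrite vy ltxx.
Qed.

Lemma lambertWE (R : realType) (z : R) : - expR (-1) <= z ->
  -1 <= lambertW z /\ lambertW z * expR (lambertW z) = z.
Proof.
move=> z1; pose f (y : R) := y * expR y.
suff [y y1 <-] : exists2 y, -1 <= y & f y = z by rewrite lambertWK.
have le1 : -1 <= Num.max 0 z by rewrite le_max lerN10.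
have cf : {within `[-1, Num.max 0 z], continuous f}.
  apply: continuous_subspaceT => x.
  by apply: cvgM; [exact: cvg_id | exact: continuous_expR].
have [|y] := IVT le1 cf (v := z).
- have fle : f (-1) <= f (Num.max 0 z).
    by move: le1; rewrite le_eqVlt => /predU1P[<-//|/mul_expR_lt/ltW]; exact.
  rewrite (min_idPl fle) (max_idPr fle) /f mulN1r z1/=.
  have [z0|z0] := leP z 0; first by rewrite mul0r.
  by rewrite ler_peMr ?(ltW z0)// -expR0 ler_expR ltW.
- by rewrite in_itv/= => /andP[y1 _] <-; exists y.
Qed.

Definition omega (R : realType) (L U beta : R) : R :=
  lambertW ((U / L - 1 - 2 * beta / L) / expR (1 + 2 * beta / L))
  + 1 + 2 * beta / L.

(* Nondecreasing in w iff L + 2 * beta <= U, that is, iff the Lambert W value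
   in omega is nonnegative; omega itself is always positive when L < U and
   0 < beta < L / 2. *)
Definition Phi (R : realType) (L U beta w : R) : R :=
  L + beta + (omega L U beta * L - L - 2 * beta) * expR (omega L U beta * w).

(* g : current price function; x' : previous decision; w : amount already sold.
   For x >= 0 the set integral is the oriented integral from w to w + x. *)
Definition objective (R : realType) (L U beta : R) (g : R -> R) (x' w x : R)
    : R :=
  g x - beta * `|x - x'|
  - \int[lebesgue_measure]_(u in `[w, w + x]) Phi L U beta u.

(* Main.v *)
(* Since U >= L + 2 beta, the Lambert W value in omega is nonnegative, so
   omega L >= L + 2 beta and the coefficient of the exponential in Phi is
   nonnegative. Hence the primitive of Phi is an affine function plus a
   nonnegative multiple of an exponential, which is convex, and f_t is a
   concave function minus two convex ones. *)
Require Import Defs.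
From HB Require Import structures.
From mathcomp Require Import all_boot all_order all_algebra.
From mathcomp Require Import all_classical all_reals all_analysis.
From mathcomp Require Import ring lra.
Import Order.TTheory GRing.Theory Num.Theory.
Import numFieldNormedType.Exports.
Local Open Scope classical_set_scope.
Local Open Scope ring_scope.

(** A product [y * expR y] has the sign of [y], and [z] lies in the range where [lambertW] is a
    genuine inverse, not the default value. *)
Lemma lambertW_ge0 (R : realType) (z : R) : 0 <= z -> 0 <= lambertW z.
Proof.
move=> z0; have [|_ Wz] := @lambertWE R z.
  by rewrite (le_trans _ z0)// oppr_le0 expR_ge0.
by rewrite -(pmulr_lge0 _ (expR_gt0 (lambertW z))) Wz.
Qed.

Lemma omega_ge (R : realType) (L U beta : R) : 0 < L -> L + 2 * beta <= U ->
  1 + 2 * beta / L <= omega L U beta.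
Proof.
move=> L0 LU; rewrite /omega -addrA lerDr lambertW_ge0// divr_ge0 ?expR_ge0//.
have -> : U / L - 1 - 2 * beta / L = (U - L - 2 * beta) / L.
  by rewrite !mulrBl divff// gt_eqF.
by rewrite divr_ge0 ?(ltW L0)//; lra.
Qed.

(** Turns the integral of [Phi] into an expression whose only nonlinear term in [x] is an
    exponential. *)
Lemma Rintegral_cst_expR (R : realType) (a c o w x : R) : o != 0 -> 0 <= x ->
  \int[lebesgue_measure]_(u in `[w, w + x]) (a + c * expR (o * u)) =
  a * x + c / o * expR (o * (w + x)) - c / o * expR (o * w).
Proof.
(* The fundamental theorem of calculus is applied on a nondegenerate interval; for [x = 0] both
   sides vanish. *)
move=> o0; rewrite le_eqVlt => /predU1P[<-|x0].
  by rewrite addr0 set_itv1 Rintegral_set1; ring.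
pose F (u : R) : R := a * u + c / o * expR (o * u).
have dF (u : R) : is_derive u 1 F (a + c * expR (o * u)).
  apply: is_derive_eq.
  by rewrite !scaler1 /GRing.scale/=; field.
have cF : continuous F.
  by move=> u; apply: differentiable_continuous; exact/derivable1_diffP.
rewrite /Rintegral (@continuous_FTC2 _ _ F) ?ltrDl//=.
- by rewrite /F; ring.
- apply: continuous_subspaceT => u.
  apply: differentiable_continuous; exact/derivable1_diffP.
- split=> [u _| |]; first exact: ex_derive.
  + exact/cvg_at_right_filter/cF.
  + exact/cvg_at_left_filter/cF.
- by move=> u _; rewrite derive1E; exact: derive_val.
Qed.

Theorem theorem10 (R : realType) (L U beta : R)
    (hL : 0 < L) (hLU : L < U)
    (hbeta0 : 0 < beta) (hbetaL : beta < L / 2)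
    (* added: if it fails, Phi is strictly decreasing and f_t is not concave
       for linear g_t *)
    (hbetaU : L + 2 * beta <= U)
    (T : nat) (g : nat -> R -> R) (x w : nat -> R)
    (t : nat) (ht : (1 <= t <= T)%N)
    (hg_ge0 : forall y : R, 0 <= y <= 1 -> 0 <= g t y)
    (hg_concave : concave_function `[0, 1] (g t))
    (hg0 : g t 0 = 0)
    (hg_deriv : derivable_oo_LRcontinuous (g t) 0 1)
    (hg_bounds : forall y : R, 0 < y < 1 -> L <= derive1 (g t) y <= U)
    (hx : 0 <= x t.-1 <= 1) (hw : 0 <= w t.-1 <= 1) :
  concave_function `[0, 1] (objective L U beta (g t) (x t.-1) (w t.-1)).
Proof.
have o_ge := @omega_ge R L U beta hL hbetaU.
have o0 : 0 < omega L U beta.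
  by rewrite (lt_le_trans _ o_ge)// ltr_wpDr// divr_ge0 ?ltW// mulr_gt0.
(* This is [o_ge] multiplied by [L]. *)
have c0 : 0 <= omega L U beta * L - L - 2 * beta.
  rewrite -addrA -opprD subr_ge0 -ler_pdivrMr// (le_trans _ o_ge)//.
  by rewrite mulrDl divff ?gt_eqF.
move=> s y z yD zD; have := hg_concave s y z yD zD.
move: yD zD; rewrite !inE/= !in_itv/= => /andP[y0 y1] /andP[z0 z1].
have p0 : 0 <= s%:num by [].
have q0 : 0 <= 1 - s%:num by rewrite subr_ge0.
rewrite /objective /Phi !Rintegral_cst_expR ?gt_eqF//; last first.
  by rewrite addr_ge0// mulr_ge0.
set k := _ / omega L U beta; have k0 : 0 <= k by rewrite divr_ge0// ltW.
(* Triangle inequality, once [x t.-1] is split with the weights [s] and [1 - s]. *)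
have habs : `|s%:num * y + (1 - s%:num) * z - x t.-1| <=
    s%:num * `|y - x t.-1| + (1 - s%:num) * `|z - x t.-1|.
  rewrite -[in X in _ <= X + _](ger0_norm p0).
  rewrite -[in X in _ <= _ + X](ger0_norm q0) -!normrM.
  apply: le_trans (ler_normD _ _); rewrite le_eqVlt; apply/predU1P; left.
  by congr `|_|; ring.
have cE : conv s y z = s%:num * y + (1 - s%:num) * z by [].
(* Affine maps commute with convex combinations, so convexity of [expR] passes to the exponential
   term of the primitive. *)
have := convex_expR s (omega L U beta * (w t.-1 + y))
  (omega L U beta * (w t.-1 + z)).
rewrite !convRE cE [X in expR X <= _](_ : _ =
  omega L U beta * (w t.-1 + (s%:num * y + (1 - s%:num) * z))); last first.
  by rewrite /unstable.onem; ring.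
(* The inequalities for [expR] and the absolute value, scaled by [k] and [beta], are added to the
   one for [g t]; affine terms cancel as the weights sum to 1. *)
rewrite /unstable.onem => /(ler_wpM2l k0).
move: habs => /(ler_wpM2l (ltW hbeta0)).
by move=> *; lra.
Qed.
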